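(* Let $A\in\mathbb{C}^{m\times n}$, $W\in\mathbb{C}^{n\times m}$ with $\mathrm{ind}(WA)=k$, and let $$A=P\begin{bmatrix}A_{11}&0\\0&A_{22}\end{bmatrix}Q^{-1},\qquad W=Q\begin{bmatrix}W_{11}&0\\0&W_{22}\end{bmatrix}P^{-1},$$ where $P\in\mathbb{C}^{m\times m}$, $Q\in\mathbb{C}^{n\times n}$ and $A_{11},W_{11}\in\mathbb{C}^{t\times t}$ are non-singular matrices, and $A_{22}W_{22}$, $W_{22}A_{22}$ are nilpotent matrices. Partition $P=\begin{bmatrix}P_1&P_2\end{bmatrix}$ and $Q=\begin{bmatrix}L_1&L_2\end{bmatrix}$ conformably with these block decompositions, i.e. $P_1\in\mathbb{C}^{m\times t}$ and $L_1\in\mathbb{C}^{n\times t}$ consist of the first $t$ columns of $P$ and $Q$ respectively. Then the $W$-weighted core-EP inverse of $A$ possesses the following representation: $$A^{\mathrm{cEP},W}=P_1(L_1^*WAWP_1)^{-1}L_1^*.$$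
   Context: For a square complex matrix $B$, $\mathrm{ind}(B)$ is the smallest non-negative integer $j$ with $\mathrm{rank}(B^j)=\mathrm{rank}(B^{j+1})$ (with $B^0=I$). $B^*$, $B^{\dagger}$ and $\mathcal{R}(B)$ denote the conjugate transpose, Moore-Penrose inverse and range (column space) of $B$. For $A\in\mathbb{C}^{m\times n}$, $W\in\mathbb{C}^{n\times m}$ and $p=\max\{\mathrm{ind}(AW),\mathrm{ind}(WA)\}$, the $W$-weighted core-EP inverse $A^{\mathrm{cEP},W}$ is the unique $Y\in\mathbb{C}^{m\times n}$ with $WAWY=(WA)^p[(WA)^p]^{\dagger}$ and $\mathcal{R}(Y)\subseteq\mathcal{R}((AW)^p)$. The displayed pair of decompositions is called the general algebraic structure (GAS) of $A$ and $W$. *)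

(* Defs.v *)
From HB Require Import structures.
From mathcomp Require Import all_boot all_order all_algebra.
From mathcomp Require Import sesquilinear spectral.
From mathcomp Require Import boolp classical_sets.

Set Implicit Arguments.
Unset Strict Implicit.
Unset Printing Implicit Defensive.

Import Order.TTheory GRing.Theory Num.Theory.

Local Open Scope classical_set_scope.
Local Open Scope sesquilinear_scope.
Local Open Scope ring_scope.

Section MatrixIndex.
Variables (F : fieldType) (n : nat).
Implicit Types B : 'M[F]_n.

Lemma mxindex_subproof B : exists j : nat, \rank (B ^+ j) == \rank (B ^+ j.+1).
Proof.
apply: contrapT => noj.
have rkS j : (\rank (B ^+ j.+1) < \rank (B ^+ j))%N.
  rewrite ltn_neqAle; apply/andP; split.
    by apply/negP => /eqP e; apply: noj; exists j; rewrite e.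
  by rewrite exprS; apply: mxrankM_maxr.
have rk j : (\rank (B ^+ j) + j <= n)%N.
  elim: j => [|j IHj]; first by rewrite addn0 rank_leq_row.
  by rewrite addnS (leq_trans _ IHj) // ltn_add2r.
by have := rk n.+1; rewrite addnS ltnNge leq_addl.
Qed.

Definition mxindex B : nat := ex_minn (mxindex_subproof B).

Definition nilpotent_mx B : Prop := exists j : nat, B ^+ j = 0.

End MatrixIndex.

Definition mxrange (F : fieldType) (m n : nat) (B : 'M[F]_(m, n)) :
  set 'cV[F]_m := range (fun x : 'cV[F]_n => B *m x).

Section MoorePenrose.
Variable C : numClosedFieldType.

Definition is_moore_penrose (m n : nat) (B : 'M[C]_(m, n)) (X : 'M[C]_(n, m)) :
    Prop :=
  [/\ B *m X *m B = B, X *m B *m X = X,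
      (B *m X)^t* = B *m X & (X *m B)^t* = X *m B].

(* The default value 0 is never used: moore_penroseP shows that a solution
   exists, and moore_penrose_unique that it is unique. *)
Definition moore_penrose (m n : nat) (B : 'M[C]_(m, n)) : 'M[C]_(n, m) :=
  xget 0 [set X | is_moore_penrose B X].

Definition is_wcore_ep (m n : nat) (A : 'M[C]_(m, n)) (W : 'M[C]_(n, m))
    (Y : 'M[C]_(m, n)) : Prop :=
  let p := maxn (mxindex (A *m W)) (mxindex (W *m A)) in
  W *m A *m W *m Y = (W *m A) ^+ p *m moore_penrose ((W *m A) ^+ p) /\
  mxrange Y `<=` mxrange ((A *m W) ^+ p).

(* The default value 0 is never used: wcore_epP shows that a solution exists,
   and wcore_ep_unique that it is unique. *)
Definition wcore_ep (m n : nat) (A : 'M[C]_(m, n)) (W : 'M[C]_(n, m)) :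
    'M[C]_(m, n) :=
  xget 0 [set Y | is_wcore_ep A W Y].

Lemma adjmxM (m n p : nat) (B : 'M[C]_(m, n)) (D : 'M[C]_(n, p)) :
  (B *m D)^t* = D^t* *m B^t*.
Proof. by rewrite trmx_mul map_mxM. Qed.

Lemma adjmx_inv (n : nat) (B : 'M[C]_n) : (invmx B)^t* = invmx (B^t* ).
Proof. by rewrite trmx_inv map_invmx. Qed.

Lemma gram_unitmx (m n : nat) (B : 'M[C]_(m, n)) :
  row_free B -> B *m B^t* \in unitmx.
Proof.
move=> Bfree; rewrite -row_free_unit; apply/inj_row_free => v vBB0.
have : v *m B *m (v *m B)^t* = 0.
  by rewrite adjmxM mulmxA -(mulmxA v) vBB0 mul0mx.
move=> /matrixP/(_ 0 0); rewrite -dotmxE [RHS]mxE => /eqP.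
rewrite dnorm_eq0 => /eqP vB0.
by apply: (row_free_inj Bfree); rewrite vB0 mul0mx.
Qed.

Lemma full_rank_moore_penrose (m n r : nat) (F : 'M[C]_(m, r))
    (G : 'M[C]_(r, n)) (K := invmx (G *m G^t* )) (H := invmx (F^t* *m F)) :
  G *m G^t* \in unitmx -> F^t* *m F \in unitmx ->
  is_moore_penrose (F *m G) (G^t* *m K *m H *m F^t* ).
Proof.
move=> GU FU.
have GK : G *m G^t* *m K = 1%:M by rewrite mulmxV.
have HF : H *m (F^t* *m F) = 1%:M by rewrite mulVmx.
have Kh : K^t* = K by rewrite adjmx_inv adjmxM trmxCK.
have Hh : H^t* = H by rewrite adjmx_inv adjmxM trmxCK.
have BX : F *m G *m (G^t* *m K *m H *m F^t* ) = F *m H *m F^t*.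
  by rewrite !mulmxA -(mulmxA F) -(mulmxA F) GK mulmx1.
have XB : G^t* *m K *m H *m F^t* *m (F *m G) = G^t* *m K *m G.
  by rewrite mulmxA -(mulmxA _ _ F) -(mulmxA _ H) HF mulmx1.
split.
- by rewrite BX mulmxA -(mulmxA _ _ F) -(mulmxA F H) HF mulmx1.
- by rewrite XB !mulmxA -(mulmxA _ G) -(mulmxA _ _ K) GK mulmx1.
- by rewrite BX !adjmxM trmxCK Hh mulmxA.
- by rewrite XB !adjmxM trmxCK Kh mulmxA.
Qed.

Lemma moore_penrose_exists (m n : nat) (B : 'M[C]_(m, n)) :
  exists X, is_moore_penrose B X.
Proof.
have GU : row_base B *m (row_base B)^t* \in unitmx.
  by apply: gram_unitmx; rewrite row_base_free.
have FU : (col_base B)^t* *m col_base B \in unitmx.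
  rewrite -[X in _ *m X]trmxCK; apply: gram_unitmx.
  by rewrite /row_free mxrank_map mxrank_tr; apply: col_base_full.
have := full_rank_moore_penrose GU FU; rewrite mulmx_base.
by set X := (X in is_moore_penrose _ X); exists X.
Qed.

Lemma moore_penrose_unique (m n : nat) (B : 'M[C]_(m, n)) X1 X2 :
  is_moore_penrose B X1 -> is_moore_penrose B X2 -> X1 = X2.
Proof.
case=> a1 b1 c1 d1 [a2 b2 c2 d2].
have e1 : B *m X1 = B *m X2.
  rewrite -c1 -{1}a2 -[_ *m B *m _]mulmxA adjmxM c1 c2.
  by rewrite mulmxA a1.
have e2 : X1 *m B = X2 *m B.
  rewrite -d1 -{1}a2 -[_ *m X2 *m _]mulmxA mulmxA adjmxM d2 d1.
  by rewrite -mulmxA [B *m _]mulmxA a1.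
by rewrite -b1 e2 -mulmxA e1 mulmxA b2.
Qed.

Lemma moore_penroseP (m n : nat) (B : 'M[C]_(m, n)) :
  is_moore_penrose B (moore_penrose B).
Proof. exact: xgetPex (moore_penrose_exists B). Qed.

Lemma mxrangeP (m n p : nat) (B : 'M[C]_(m, n)) (D : 'M[C]_(m, p)) :
  mxrange B `<=` mxrange D <-> exists Z, B = D *m Z.
Proof.
split=> [BD|[Z ->] _ [x _ <-]]; last by exists (Z *m x); rewrite ?mulmxA.
have /submxP[Z] : (B^T <= D^T)%MS.
  apply/row_subP => i; have [x _ Dx] : mxrange D (col i B).
    by apply: BD; exists (delta_mx i 0); rewrite -?colE.
  by rewrite -tr_col -Dx trmx_mul submxMl.
by move=> /(congr1 trmx); rewrite trmxK trmx_mul trmxK => ->; exists Z^T.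
Qed.

Lemma mxindex_stable_row (n p : nat) (B : 'M[C]_n) (i : nat) :
  (mxindex B <= p)%N -> exists Z, B ^+ p = Z * B ^+ (p + i).
Proof.
rewrite /mxindex; case: ex_minnP => k /eqP rkk _ lekp.
have sub : (B ^+ k.+1 <= B ^+ k)%MS by rewrite exprS submxMl.
have /submxP[Z ZE] : (B ^+ k <= B ^+ k.+1)%MS.
  by rewrite -(mxrank_leqif_sup sub) rkk.
have {}ZE : B ^+ k = Z * B ^+ k.+1 by rewrite {1}ZE.
have step j : (k <= j)%N -> B ^+ j = Z * B ^+ j.+1.
  by move=> lekj; rewrite -(subnKC lekj) -addSn !exprD {1}ZE mulrA.
elim: i => [|i [Y YE]]; first by exists 1; rewrite addn0 mul1r.
exists (Y * Z); rewrite addnS -mulrA -step //.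
by rewrite (leq_trans lekp) ?leq_addr.
Qed.

Lemma mxindex_stable (n p : nat) (B : 'M[C]_n) (i : nat) :
  (mxindex B <= p)%N -> exists Z, B ^+ p = B ^+ (p + i) * Z.
Proof.
rewrite /mxindex; case: ex_minnP => k /eqP rkk _ lekp.
have sub : ((B ^+ k.+1)^T <= (B ^+ k)^T)%MS.
  by rewrite exprSr trmx_mul submxMl.
have /submxP[Z ZE] : ((B ^+ k)^T <= (B ^+ k.+1)^T)%MS.
  by rewrite -(mxrank_leqif_sup sub) !mxrank_tr rkk.
have {}ZE : B ^+ k = B ^+ k.+1 * Z^T.
  by rewrite -[LHS]trmxK ZE trmx_mul trmxK.
have step j : (k <= j)%N -> B ^+ j = B ^+ j.+1 * Z^T.
  by move=> lekj; rewrite -(subnK lekj) -addnS !exprD {1}ZE mulrA.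
elim: i => [|i [Y YE]]; first by exists 1; rewrite addn0 mulr1.
exists (Z^T * Y); rewrite addnS mulrA -step //.
by rewrite (leq_trans lekp) ?leq_addr.
Qed.

Lemma wcore_ep_exists (m n : nat) (A : 'M[C]_(m, n)) (W : 'M[C]_(n, m)) :
  exists Y, is_wcore_ep A W Y.
Proof.
set p := maxn (mxindex (A *m W)) (mxindex (W *m A)).
have [Z ZE] := @mxindex_stable _ p (W *m A) 2 (leq_maxr _ _).
pose X := moore_penrose ((W *m A) ^+ p).
exists ((A *m W) ^+ p *m (A *m Z *m X)); split; last first.
  by apply/mxrangeP; exists (A *m Z *m X).
have shift q : W *m (A *m W) ^+ q = (W *m A) ^+ q *m W.
  elim: q => [|q IHq]; first by rewrite mulmx1 mul1mx.
  rewrite exprSr [(W *m A) ^+ _]exprSr -[_ ^+ q * _]/(_ *m _) mulmxA IHq.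
  by rewrite -[_ ^+ q * _]/(_ *m _) !mulmxA.
have {}ZE : (W *m A) ^+ p = W *m A *m (W *m A) *m (W *m A) ^+ p *m Z.
  by rewrite {1}ZE addnC exprD expr2.
have comm : (W *m A) ^+ p *m (W *m A) = W *m A *m (W *m A) ^+ p.
  by transitivity ((W *m A) ^+ p.+1); [rewrite exprSr | rewrite exprS].
rewrite -/p -/X [in RHS]ZE mulmxA -(mulmxA (W *m A)) shift.
by rewrite mulmxA !mulmxA -(mulmxA _ W A) -(mulmxA _ _ (W *m A)) comm !mulmxA.
Qed.

Lemma wcore_ep_unique (m n : nat) (A : 'M[C]_(m, n)) (W : 'M[C]_(n, m)) Y1 Y2 :
  is_wcore_ep A W Y1 -> is_wcore_ep A W Y2 -> Y1 = Y2.
Proof.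
set p := maxn (mxindex (A *m W)) (mxindex (W *m A)).
case=> e1 /mxrangeP[Z1 Y1E] [e2 /mxrangeP[Z2 Y2E]].
have [Z ZE] := @mxindex_stable_row _ p (A *m W) 2 (leq_maxl _ _).
have AWY (Y : 'M[C]_(m, n)) :
    (A *m W) ^+ (2 + p) *m Y = A *m (W *m A *m W *m ((A *m W) ^+ p *m Y)).
  by rewrite exprD expr2 -!mulmxE !mulmxA.
have {}ZE : (A *m W) ^+ p = Z *m (A *m W) ^+ (2 + p) by rewrite {1}ZE addnC.
by rewrite Y1E Y2E [in LHS]ZE [in RHS]ZE -!(mulmxA Z) !AWY -Y1E -Y2E e1 e2.
Qed.

Lemma wcore_epP (m n : nat) (A : 'M[C]_(m, n)) (W : 'M[C]_(n, m)) :
  is_wcore_ep A W (wcore_ep A W).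
Proof. exact: xgetPex (wcore_ep_exists A W). Qed.

End MoorePenrose.

(* Main.v *)
Require Import Defs.
From HB Require Import structures.
From mathcomp Require Import all_boot all_order all_algebra.
From mathcomp Require Import sesquilinear spectral.
From mathcomp Require Import reals complex.

Set Implicit Arguments.
Unset Strict Implicit.
Unset Printing Implicit Defensive.

Import Order.TTheory GRing.Theory Num.Theory.

Local Open Scope sesquilinear_scope.
Local Open Scope ring_scope.

(** Writing the two block decompositions column by column gives [A L1 = P1 A11]
    and [W P1 = L1 W11], so [W A W P1 = L1 D] with [D = W11 A11 W11] invertible.
    As [L1] has independent columns, its Gram matrix [L1^* L1] is invertible,
    hence so is [L1^* W A W P1 = (L1^* L1) D], and the candidate is
    [Y = P1 D^-1 (L1^* L1)^-1 L1^*].  Since the weighted core-EP inverse is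
    unique, it suffices to check the two conditions that define it.

    First, [W A W Y = L1 (L1^* L1)^-1 L1^*] is the orthogonal projector onto the
    column space of [L1], whereas [B B^dagger] is the orthogonal projector onto
    the column space of [B = (W A)^p]; these agree as soon as [B] and [L1] have
    the same column space ([mulmx_moore_penrose_range]).  One inclusion holds
    because [W A] acts on [L1] through the invertible matrix [W11 A11]
    ([invariant_sub_pow]).  For the other, a high enough power of [W A] kills
    the nilpotent block and so has its columns in the span of [L1]
    ([block_diag_pow_range]); since [p] is at least the index of [W A], the
    columns of [(W A)^p] already lie in the span of those of that higher power.

    Second, the columns of [Y] are combinations of those of [P1], on which [A W]
    acts through the invertible matrix [A11 W11], so they lie in the column
    space of [(A W)^p]. *)

Section ColumnSpaces.
Variable C : numClosedFieldType.

(** Independence of the columns of [L] is expressed by a left inverse because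
    that is what the inverse of a matrix with [L] as a block supplies: its rows
    matching that block. *)
Lemma left_inv_gram_unitmx (n t : nat) (L : 'M[C]_(n, t)) (U : 'M[C]_(t, n)) :
  U *m L = 1%:M -> L^t* *m L \in unitmx.
Proof.
move=> UL; rewrite -[X in _ *m X]trmxCK; apply: gram_unitmx.
apply/row_freeP; exists (U^t* ).
by rewrite -adjmxM UL trmx1 map_mx1.
Qed.

(** Both sides are Hermitian idempotents.  Equality of the column spaces of [B]
    and [L] makes each of them act as the identity on the range of the other,
    and two Hermitian matrices [S], [T] with [S T = T] and [T S = S] are
    equal: [S = S^* = (T S)^* = S T = T]. *)
Lemma mulmx_moore_penrose_range (n q t : nat) (B : 'M[C]_(n, q))
    (L : 'M[C]_(n, t)) (G : 'M[C]_(t, q)) (H : 'M[C]_(q, t)) :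
    L^t* *m L \in unitmx -> B = L *m G -> L = B *m H ->
  B *m moore_penrose B = L *m invmx (L^t* *m L) *m L^t*.
Proof.
move=> LU BE LE; have [BXB _ BXh _] := moore_penroseP B.
set S := B *m moore_penrose B in BXB BXh *.
set T := RHS.
have Th : T^t* = T by rewrite /T !adjmxM adjmx_inv adjmxM !trmxCK mulmxA.
have TL : T *m L = L by rewrite /T -!mulmxA mulVmx ?mulmx1.
have SL : S *m L = L by rewrite LE mulmxA BXB.
have TS : T *m S = S by rewrite /S {1 3}BE !mulmxA TL.
have ST : S *m T = T by rewrite /T !mulmxA SL.
by rewrite -BXh -TS adjmxM BXh Th ST.
Qed.

(** [B] maps the span of [L] onto itself because [M] is invertible, hence so
    does every power of [B]. *)
Lemma invariant_sub_pow (n t : nat) (B : 'M[C]_n) (L : 'M[C]_(n, t))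
    (M : 'M[C]_t) (p : nat) :
  B *m L = L *m M -> M \in unitmx -> exists H, L = B ^+ p *m (L *m H).
Proof.
move=> BL MU; elim: p => [|p [H LE]].
  by exists 1%:M; rewrite mulmx1 mul1mx.
have LB : L = B *m L *m invmx M by rewrite BL mulmxK.
exists (invmx M *m H).
by rewrite exprSr -mulmxE {1}LE {1}LB !mulmxA.
Qed.

(** Once the power [q] annihilates the second block, only the first block
    contributes columns. *)
Lemma block_diag_pow_range (t s : nat) (L1 : 'M[C]_(t + s, t))
    (L2 : 'M[C]_(t + s, s)) (M : 'M[C]_t) (N : 'M[C]_s) (q : nat)
    (Q := row_mx L1 L2) :
    Q \in unitmx -> N ^+ q = 0 ->
  exists G, (Q *m block_mx M 0 0 N *m invmx Q) ^+ q = L1 *m G.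
Proof.
move=> QU Nq.
have powE j : (Q *m block_mx M 0 0 N *m invmx Q) ^+ j =
    Q *m block_mx (M ^+ j) 0 0 (N ^+ j) *m invmx Q.
  elim: j => [|j IHj]; first by rewrite -scalar_mx_block mulmx1 mulmxV.
  rewrite !exprSr {}IHj -!mulmxE !mulmxA mulmxKV // -(mulmxA Q) mulmx_block.
  by rewrite !mulmx0 !mul0mx !addr0 !add0r.
exists (row_mx (M ^+ q) 0 *m invmx Q).
rewrite powE Nq mulmxA mul_row_block !mulmx0 !addr0.
by rewrite mul_mx_row mulmx0.
Qed.

(** [invmx Q *m L1] consists of the first [t] columns of the identity matrix,
    so the product picks out the first block column. *)
Lemma block_diag_mul_left (m n t r s : nat) (P1 : 'M[C]_(m, t))
    (P2 : 'M[C]_(m, r)) (L1 : 'M[C]_(t + s, t)) (L2 : 'M[C]_(t + s, s))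
    (A11 : 'M[C]_t) (A22 : 'M[C]_(r, s)) (Q := row_mx L1 L2) :
    Q \in unitmx ->
  row_mx P1 P2 *m block_mx A11 0 0 A22 *m invmx Q *m L1 = P1 *m A11.
Proof.
move=> QU.
have L1E : L1 = Q *m col_mx 1%:M 0.
  by rewrite mul_row_col mulmx1 mulmx0 addr0.
rewrite [X in _ *m X]L1E mulmxA mulmxKV // -mulmxA mul_block_col mul_row_col.
by rewrite !mulmx1 !mulmx0 !addr0 mulmx0 addr0.
Qed.

End ColumnSpaces.

Theorem corollary2p8 (R : realType) (t r s k : nat)
    (A : 'M[R[i]]_(t + r, t + s)) (W : 'M[R[i]]_(t + s, t + r))
    (P : 'M[R[i]]_(t + r)) (Q : 'M[R[i]]_(t + s))
    (A11 W11 : 'M[R[i]]_t) (A22 : 'M[R[i]]_(r, s)) (W22 : 'M[R[i]]_(s, r))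
    (P1 : 'M[R[i]]_(t + r, t)) (P2 : 'M[R[i]]_(t + r, r))
    (L1 : 'M[R[i]]_(t + s, t)) (L2 : 'M[R[i]]_(t + s, s))
    (indWA : mxindex (W *m A) = k)
    (defA : A = P *m block_mx A11 0 0 A22 *m invmx Q)
    (defW : W = Q *m block_mx W11 0 0 W22 *m invmx P)
    (unitP : P \in unitmx) (unitQ : Q \in unitmx)
    (unitA11 : A11 \in unitmx) (unitW11 : W11 \in unitmx)
    (nilAW : nilpotent_mx (A22 *m W22)) (nilWA : nilpotent_mx (W22 *m A22))
    (defP : P = row_mx P1 P2) (defQ : Q = row_mx L1 L2) :
  L1^t* *m W *m A *m W *m P1 \in unitmx /\
  wcore_ep A W = P1 *m invmx (L1^t* *m W *m A *m W *m P1) *m L1^t*.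
Proof.
set p := maxn (mxindex (A *m W)) (mxindex (W *m A)).
have QU : row_mx L1 L2 \in unitmx by rewrite -defQ.
have AL : A *m L1 = P1 *m A11.
  by rewrite defA defP defQ block_diag_mul_left.
have WP : W *m P1 = L1 *m W11.
  by rewrite defW defP defQ block_diag_mul_left // -defP.
have WAE : W *m A =
    row_mx L1 L2 *m block_mx (W11 *m A11) 0 0 (W22 *m A22) *m
      invmx (row_mx L1 L2).
  rewrite defA defW -defQ !mulmxA mulmxKV // -(mulmxA Q) mulmx_block.
  by rewrite !mulmx0 !mul0mx !addr0 !add0r.
have gramU : L1^t* *m L1 \in unitmx.
  apply: (@left_inv_gram_unitmx _ _ _ _ (usubmx (invmx (row_mx L1 L2)))).
  have := mulVmx QU; rewrite -{1}[invmx _]vsubmxK mul_col_row scalar_mx_block.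
  by case/eq_block_mx.
set D := W11 *m A11 *m W11.
have DU : D \in unitmx by rewrite !unitmx_mul unitW11 unitA11.
have WAWP : W *m A *m W *m P1 = L1 *m D.
  by rewrite -mulmxA WP -!mulmxA (mulmxA A) AL -mulmxA (mulmxA W) WP !mulmxA.
have GE : L1^t* *m W *m A *m W *m P1 = L1^t* *m L1 *m D.
  by rewrite -[RHS]mulmxA -WAWP !mulmxA.
have GU : L1^t* *m W *m A *m W *m P1 \in unitmx by rewrite GE unitmx_mul gramU.
split=> //; apply: wcore_ep_unique (wcore_epP A W) _; split; rewrite -/p.
- have [H LH] : exists H, L1 = (W *m A) ^+ p *m (L1 *m H).
    apply: (@invariant_sub_pow _ _ _ _ _ (W11 *m A11)).
      by rewrite -mulmxA AL mulmxA WP mulmxA.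
    by rewrite unitmx_mul unitW11.
  have [G BG] : exists G, (W *m A) ^+ p = L1 *m G.
    have [q Nq] := nilWA.
    have [G GqE] := block_diag_pow_range (W11 *m A11) QU Nq.
    have [Z ZE] := @mxindex_stable _ _ p (W *m A) q (leq_maxr _ _).
    exists (G *m ((W *m A) ^+ p *m Z)).
    by rewrite {1}ZE (addnC p) exprD WAE GqE -!mulmxE !mulmxA.
  rewrite (mulmx_moore_penrose_range gramU BG LH) !mulmxA WAWP.
  have DG : D *m invmx (L1^t* *m L1 *m D) = invmx (L1^t* *m L1).
    rewrite -[LHS](mulKmx gramU) (mulmxA (_ *m L1)) mulmxV ?mulmx1 //.
    by rewrite unitmx_mul gramU.
  by rewrite -DG -GE !mulmxA.
- apply/mxrangeP.
  have [H PH] : exists H, P1 = (A *m W) ^+ p *m (P1 *m H).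
    apply: (@invariant_sub_pow _ _ _ _ _ (A11 *m W11)).
      by rewrite -mulmxA WP mulmxA AL mulmxA.
    by rewrite unitmx_mul unitA11.
  by eexists; rewrite {1}PH -!mulmxA; reflexivity.
Qed.
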